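(* Let $(\mathfrak g,J,g)$ be an almost abelian pseudo-Kähler Lie algebra, with codimension-one abelian ideal $\mathfrak h$, such that $\mathfrak h_0=\mathfrak h^\perp\oplus J\mathfrak h^\perp$ is non-isotropic. Then $(\mathfrak g,J,g)$ is an algebraic Ricci soliton; that is, there exist $\lambda\in\mathbb R$ and a derivation $\delta\in\mathrm{Der}(\mathfrak g)$ such that $\mathrm{ric}=\lambda\,\mathrm{Id}+\delta$.
   Context: Lie algebras are real and finite-dimensional. A Lie algebra is almost abelian if it has a codimension-one abelian ideal $\mathfrak h$. A pseudo-Kähler structure on $\mathfrak g$ is a pair $(J,g)$ with $J\in\mathrm{End}(\mathfrak g)$, $J^2=-\mathrm{Id}$, $[X,Y]+J[JX,Y]+J[X,JY]-[JX,JY]=0$; $g$ a nondegenerate symmetric bilinear form of arbitrary signature with $g(JX,JY)=g(X,Y)$; and $\omega=g(J\cdot,\cdot)$ satisfying $\omega([X,Y],Z)+\omega([Y,Z],X)+\omega([Z,X],Y)=0$. The orthogonal $\mathfrak h^\perp$ is one-dimensional and $g|_{\mathfrak h_0}$ is either definite ($\mathfrak h_0$ non-isotropic) or zero ($\mathfrak h_0$ isotropic). The Levi-Civita connection $\nabla$ of the corresponding left-invariant metric is given on $\mathfrak g$ by $2g(\nabla_XY,Z)=g([X,Y],Z)-g([Y,Z],X)+g([Z,X],Y)$; $R(X,Y)=[\nabla_X,\nabla_Y]-\nabla_{[X,Y]}$; $\mathrm{Ric}(v,w)=\mathrm{tr}(X\mapsto R(X,v)w)$; and the Ricci endomorphism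 $\mathrm{ric}$ is defined by $\mathrm{Ric}=g(\mathrm{ric}\,\cdot,\cdot)$. *)

(* Defs.v *)
From HB Require Import structures.
From mathcomp Require Import all_boot all_order all_algebra.
From mathcomp Require Import sesquilinear.
From mathcomp Require Import ring.
From mathcomp Require Import boolp classical_sets reals.

Set Implicit Arguments.
Unset Strict Implicit.
Unset Printing Implicit Defensive.

Import Order.TTheory GRing.Theory Num.Theory.
Local Open Scope ring_scope.

Section LieAlgebra.
Variables (R : realType) (V : vectType R).
Implicit Types (br : {bilinear V -> V -> V}) (h : {vspace V}) (d : 'End(V)).

Record lie_bracket br : Prop := LieBracket {
  lie_alternating : forall x, br x x = 0;
  lie_jacobi : forall x y z,
    br x (br y z) + br y (br z x) + br z (br x y) = 0
}.

Record codim1_abelian_ideal br h : Prop := Codim1AbelianIdeal {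
  ideal_stable : forall x y, y \in h -> br x y \in h;
  ideal_abelian : {in h &, forall x y, br x y = 0};
  ideal_codim1 : (\dim h).+1 = \dim {:V}
}.

Definition derivation br d : Prop :=
  forall x y, d (br x y) = br (d x) y + br x (d y).

Definition lftrace (f : 'End(V)) : R :=
  \tr (passmx.mxof (vbasis {:V}) (vbasis {:V}) f).

Lemma lftrace_linear : linear (lftrace : 'End(V) -> R^o).
Proof. by move=> a p q; rewrite /lftrace passmx.mxof_linear mxtraceD mxtraceZ. Qed.

End LieAlgebra.

Section PseudoKahler.
Variables (R : realType) (V : vectType R).
Implicit Types (br : {bilinear V -> V -> V}) (J : 'End(V)).
Implicit Types (g : {symmetric V}) (h : {vspace V}).

Record complex_structure br J : Prop := ComplexStructure {
  complex_sqr : forall x, J (J x) = - x;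
  complex_integrable : forall x y,
    br x y + J (br (J x) y) + J (br x (J y)) - br (J x) (J y) = 0
}.

Definition kahler_form J g (x y : V) : R := g (J x) y.

Record pseudo_kahler br J g : Prop := PseudoKahler {
  pk_complex : complex_structure br J;
  pk_nondegenerate : nondegenerate g;
  pk_hermitian : forall x y, g (J x) (J y) = g x y;
  pk_closed : forall x y z,
    kahler_form J g (br x y) z + kahler_form J g (br y z) x
      + kahler_form J g (br z x) y = 0
}.

(* When h has codimension one and g is nondegenerate, orthov g h is a line; J
   has no real eigenvector, so the sum is then direct. *)
Definition h0 J g h : {vspace V} :=
  (orthov g h + J @: orthov g h)%VS.

Definition definite_on g (U : {vspace V}) : Prop :=
  {in U, forall x, x != 0 -> 0 < g x x} \/
  {in U, forall x, x != 0 -> g x x < 0}.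

Definition non_isotropic J g h : Prop := definite_on g (h0 J g h).

End PseudoKahler.

Section Curvature.
Variables (R : realType) (V : vectType R).
Variables (br : {bilinear V -> V -> V}) (g : {symmetric V}).

(* The vector u such that g u = phi; it exists and is unique as soon as g is
   nondegenerate and phi is linear (see sharpP and sharp_uniq). *)
Definition sharp (phi : V -> R) : V :=
  xget 0 [set u | forall z, g u z = phi z]%classic.

Definition koszul (x y z : V) : R :=
  g (br x y) z - g (br y z) x + g (br z x) y.

(* linfun f agrees with f only if f is linear; this is checked below for the
   three functions to which it is applied (for g nondegenerate). *)
Definition levi_civita (x : V) : 'End(V) :=
  linfun (fun y => sharp (fun z => 2^-1 * koszul x y z)).

Definition curvature (x y : V) : 'End(V) :=
  (levi_civita x \o levi_civita y)%VF - (levi_civita y \o levi_civita x)%VF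
    - levi_civita (br x y).

Definition ricci (v w : V) : R :=
  lftrace (linfun (fun x => curvature x v w)).

Definition ricci_endo : 'End(V) := linfun (fun v => sharp (ricci v)).

Lemma linfun_linearE (U W : vectType R) (f : U -> W) :
  linear f -> linfun f =1 f.
Proof.
move=> lf; pose ff : {linear U -> W} :=
  HB.pack f (GRing.isLinear.Build _ _ _ _ f lf).
exact: (lfunE ff).
Qed.

Hypothesis g_nondeg : nondegenerate g.

Lemma metricl a u v z : g (a *: u + v) z = a * g u z + g v z.
Proof. exact: linearPl. Qed.

Lemma metricr a u v z : g z (a *: u + v) = a * g z u + g z v.
Proof. exact: linearPr. Qed.

Lemma nondegenerate_inj u v : (forall z, g u z = g v z) -> u = v.
Proof.
move=> guv; apply/eqP; rewrite -subr_eq0 -memv0 -(eqP g_nondeg).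
apply/mem_orthovP => z _; rewrite linearBl.
by apply/eqP; rewrite subr_eq0; apply/eqP/guv.
Qed.

Lemma sharpP (phi : V -> R) :
  linear (phi : V -> R^o) -> forall z, g (sharp phi) z = phi z.
Proof.
move=> lphi.
suff: exists u, [set u | forall z, g u z = phi z]%classic u by move/(xgetPex 0).
pose flat u : 'Hom(V, R^o) := linfun (g u : V -> R^o).
have flatE u z : flat u z = g u z.
  by rewrite linfun_linearE // => a x y; rewrite metricr.
have lflat : linear flat.
  move=> a x y; apply/lfunP => z.
  by rewrite add_lfunE scale_lfunE !flatE metricl.
pose F := linfun flat.
have FE : F =1 flat := linfun_linearE lflat.
have kF : lker F == 0%VS.
  apply/lker0P => u v; rewrite !FE => /lfunP e.
  by apply: nondegenerate_inj => z; rewrite -!flatE e.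
have sF : limg F = fullv.
  apply/eqP; rewrite eqEdim subvf /= limg_dim_eq; last first.
    by rewrite (eqP kF) capv0.
  by rewrite !dimvf /dim /= muln1.
have : linfun (phi : V -> R^o) \in limg F by rewrite sF memvf.
case/memv_imgP => u _ e; exists u => z /=.
by rewrite -flatE -FE -e linfun_linearE.
Qed.

Lemma sharp_uniq (phi : V -> R) u :
  linear (phi : V -> R^o) -> (forall z, g u z = phi z) -> u = sharp phi.
Proof. by move=> lp e; apply: nondegenerate_inj => z; rewrite sharpP. Qed.

Lemma koszul_lin3 x y : linear (koszul x y : V -> R^o).
Proof.
move=> a u v; rewrite /koszul !(linearPr br, linearPl br).
by rewrite !(metricr, metricl) /GRing.scale /=; ring.
Qed.

Lemma koszul_lin2 x z : linear ((fun y => koszul x y z) : V -> R^o).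
Proof.
move=> a u v; rewrite /koszul !(linearPr br, linearPl br).
by rewrite !(metricr, metricl) /GRing.scale /=; ring.
Qed.

Lemma koszul_lin1 y z : linear ((fun x => koszul x y z) : V -> R^o).
Proof.
move=> a u v; rewrite /koszul !(linearPr br, linearPl br).
by rewrite !(metricr, metricl) /GRing.scale /=; ring.
Qed.

Lemma levi_civitaE x y z : g (levi_civita x y) z = 2^-1 * koszul x y z.
Proof.
have lk u v : linear ((fun z => 2^-1 * koszul u v z) : V -> R^o).
  by move=> a p q; rewrite koszul_lin3 /GRing.scale /=; ring.
rewrite linfun_linearE ?sharpP // => a u v.
apply: nondegenerate_inj => w.
by rewrite metricl !sharpP // koszul_lin2 /GRing.scale /=; ring.
Qed.

Lemma levi_civitaP x y z : 2 * g (levi_civita x y) z =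
  g (br x y) z - g (br y z) x + g (br z x) y.
Proof. by rewrite levi_civitaE mulVKf // pnatr_eq0. Qed.

Lemma levi_civita_linear : linear levi_civita.
Proof.
move=> a u v; apply/lfunP => y; apply: nondegenerate_inj => z.
rewrite add_lfunE scale_lfunE metricl !levi_civitaE koszul_lin1 /GRing.scale /=.
ring.
Qed.

Lemma levi_civitaD a u v y :
  levi_civita (a *: u + v) y = a *: levi_civita u y + levi_civita v y.
Proof. by rewrite levi_civita_linear add_lfunE scale_lfunE. Qed.

Lemma curvatureE x y z : curvature x y z =
  levi_civita x (levi_civita y z) - levi_civita y (levi_civita x z)
    - levi_civita (br x y) z.
Proof. by rewrite /curvature !add_lfunE !opp_lfunE !comp_lfunE. Qed.

Lemma linear_mix a (p1 p2 q1 q2 r1 r2 : V) :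
  a *: p1 + p2 - (a *: q1 + q2) - (a *: r1 + r2) =
  a *: (p1 - q1 - r1) + (p2 - q2 - r2).
Proof. by rewrite !scalerBr !opprD (addrACA (a *: p1)) (addrACA (a *: p1 - _)). Qed.

Lemma curvature_lin1 y z : linear (fun x => curvature x y z).
Proof.
move=> a u v; rewrite !curvatureE (linearPl br) !levi_civitaD linearP.
exact: linear_mix.
Qed.

Lemma curvature_lin2 x z : linear (fun y => curvature x y z).
Proof.
move=> a u v; rewrite !curvatureE (linearPr br) !levi_civitaD linearP.
exact: linear_mix.
Qed.

Lemma ricci_lin1 w : linear ((fun v => ricci v w) : V -> R^o).
Proof.
move=> a u v; rewrite /ricci -lftrace_linear; congr lftrace; apply/lfunP => x.
rewrite add_lfunE scale_lfunE !(linfun_linearE (curvature_lin1 _ _)).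
exact: curvature_lin2.
Qed.

Lemma ricci_lin2 v : linear (ricci v : V -> R^o).
Proof.
move=> a u w; rewrite /ricci -lftrace_linear; congr lftrace; apply/lfunP => x.
rewrite add_lfunE scale_lfunE !(linfun_linearE (curvature_lin1 _ _)).
exact: linearP.
Qed.

Lemma ricci_endoP v w : ricci v w = g (ricci_endo v) w.
Proof.
rewrite linfun_linearE => [|a x y]; first by rewrite sharpP //; exact: ricci_lin2.
apply: nondegenerate_inj => z; rewrite metricl !sharpP; try exact: ricci_lin2.
exact: ricci_lin1.
Qed.

End Curvature.

(* Main.v *)
Require Import Defs.
From mathcomp Require Import all_boot all_order all_algebra.
From mathcomp Require Import sesquilinear.
From mathcomp Require Import boolp reals.
From mathcomp Require Import ring lra.

(** Since the plane spanned by the normal line of h and its image under J is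
    definite, a normal vector e of h has c = g(e,e) <> 0, and
    V = <e> + h. Put f = J e, which lies in h, and call a vector horizontal if
    it is orthogonal to e and f. Write D = ad e. As h is abelian, D
    carries the whole bracket.
    - Integrability of J, on e and a horizontal w, says that D commutes with J
      on horizontal vectors; hence D preserves them.
    - Closedness of the Kaehler form, on e and two elements of h, then says
      that D is skew on horizontal vectors and that D f has no horizontal part,
      so D f = a f for a scalar a.
    These facts make up [split_form], and [split_form_normal] proves them. They
    express g as the orthogonal sum of a plane of constant curvature
    (spanned by e and f) and a flat part on which e acts by infinitesimal
    isometries.

    In this form the Levi-Civita connection is
      nabla_x y = alpha(x) A y + a beta(x) S y,
    where alpha, beta are the e- and f-coordinates, A is the skew part of D,
    and S is a rotation generator of the plane (sending e to -f and f to e).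
    Since A S = S A = 0 ([levi_civita_split], [skew_turn], [turn_skew]), only
    the term nabla_[x,y] contributes to the curvature, which is a multiple of
    S; its trace is immediate. So ric is -a^2/c times the orthogonal projection
    onto the plane ([ricci_endo_split]), that is, -a^2/c times the
    identity plus a^2/c times the projection onto the horizontal space, and the
    latter projection is a derivation because D preserves the splitting
    and the horizontal space is an ideal that commutes with f
    ([horizontal_proj_derivation]). *)

Set Implicit Arguments.
Unset Strict Implicit.
Unset Printing Implicit Defensive.
Import Order.TTheory GRing.Theory Num.Theory.
Local Open Scope ring_scope.

(** * Linear algebra *)

Lemma lftrace_rank_one (R : realType) (V : vectType R) (phi : 'Hom(V, R^o))
    (u : V) :
  lftrace (linfun (fun x => phi x *: u)) = phi u.
Proof.
have lin : linear (fun x => phi x *: u).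
  by move=> a x y; rewrite linearP scalerDl scalerA.
rewrite [u in RHS](coord_vbasis (memvf u)) linear_sum.
rewrite /lftrace /mxtrace; apply: eq_bigr => i _.
rewrite mxE /= passmx.vecof_delta (linfun_linearE lin).
by rewrite mxE !linearZ /= mulrC.
Qed.

(** Rank-nullity: orthogonality to U is a system of dim U linear equations. *)
Lemma orthov_proper_neq0 (R : realType) (V : vectType R) (g : {symmetric V})
    (U : {vspace V}) :
  (\dim U < \dim {:V})%N -> exists2 e, e \in orthov g U & e != 0.
Proof.
move=> ltUV; pose F x : 'rV[R]_(\dim U) := \row_i g (vbasis U)`_i x.
have linF : linear F.
  by move=> a x y; apply/rowP => i; rewrite !mxE metricr.
have kerF x : x \in lker (linfun F) -> x \in orthov g U.
  rewrite memv_ker (linfun_linearE linF) => /eqP/rowP Fx0.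
  apply/mem_orthovP => v /coord_vbasis ->.
  rewrite linear_sumr big1 // => i _; rewrite linearZr_LR /=.
  have := Fx0 i; rewrite !mxE hermC /= expr0 mul1r => ->.
  by rewrite mulr0.
exists (vpick (lker (linfun F))); first by rewrite kerF // memv_pick.
rewrite vpick0; apply/negP => /eqP ker0.
have := limg_ker_dim (linfun F) fullv; rewrite ker0 capv0 dimv0 add0n => eqd.
have := dimvS (subvf (linfun F @: fullv)); rewrite eqd.
by rewrite [X in (_ <= X)%N]dimvf dim_matrix mul1r leqNgt ltUV.
Qed.

Section Metric.
Variables (R : realType) (V : vectType R) (g : {symmetric V}).

Lemma metricC u v : g u v = g v u.
Proof. by rewrite hermC /= expr0 mul1r. Qed.

Lemma metricDl u v z : g (u + v) z = g u z + g v z.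
Proof. by rewrite -[u]scale1r metricl scale1r mul1r. Qed.
Lemma metric0l z : g 0 z = 0.
Proof. exact: linear0l. Qed.
Lemma metricZl a u z : g (a *: u) z = a * g u z.
Proof. by rewrite -[a *: u]addr0 metricl metric0l addr0. Qed.
Lemma metricNl u z : g (- u) z = - g u z.
Proof. by rewrite -scaleN1r metricZl mulN1r. Qed.
Lemma metricDr u v z : g z (u + v) = g z u + g z v.
Proof. by rewrite !(metricC z) metricDl. Qed.
Lemma metricZr a u z : g z (a *: u) = a * g z u.
Proof. by rewrite !(metricC z) metricZl. Qed.
Lemma metricNr u z : g z (- u) = - g z u.
Proof. by rewrite !(metricC z) metricNl. Qed.
Lemma metric0r z : g z 0 = 0.
Proof. exact: linear0r. Qed.

(** Once [nondegenerate_inj] has turned an identity of vectors into one of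
    scalars, these rules leave it to [ring] or [field]. *)
Definition metricE :=
  (metricDl, metricZl, metricNl, metricDr, metricZr, metricNr).
End Metric.

(** * Connection, curvature and Ricci operator in normal form *)

Section NormalForm.
Variables (R : realType) (V : vectType R) (br : {bilinear V -> V -> V}).
Variables (g : {symmetric V}) (e f : V) (D : 'End(V)) (a c : R).

(** What the complex structure and the abelian ideal impose on D = ad e. The
    last identity says that the symmetric part of D for g is a times the
    orthogonal projection onto the line of f. *)
Record split_form : Prop := SplitForm {
  split_nondegenerate : nondegenerate g;
  split_neq0 : c != 0;
  split_ee : g e e = c;
  split_ff : g f f = c;
  split_ef : g e f = 0;
  split_bracket : forall x y,
    br x y = (g e x / c) *: D y - (g e y / c) *: D x;
  split_De : D e = 0;
  split_Df : D f = a *: f;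
  split_gD : forall x y,
    g (D x) y + g x (D y) = 2 * a * (g f x / c) * g f y
}.

Hypothesis P : split_form.
Let c0 : c != 0 := split_neq0 P.
Let nd := split_nondegenerate P.

Lemma split_eD x : g e (D x) = 0.
Proof.
have := split_gD P e x.
rewrite (split_De P) metric0l add0r => ->.
by rewrite (metricC g f) (split_ef P) mul0r mulr0 mul0r.
Qed.

Lemma split_fD x : g f (D x) = a * g f x.
Proof.
have := split_gD P f x; rewrite (split_Df P) metricZl (split_ff P) divff //.
by move=> H; apply: (addrI (a * g f x)); rewrite H; ring.
Qed.

(** The covariant derivative along e. *)
Definition skew_part y := D y - (a * g f y / c) *: f.

(** The rotation generator e |-> -f, f |-> e of the plane spanned by e and f,
    zero on its complement; the covariant derivative along f is a multiple
    of it. *)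
Definition turn y := (g f y / c) *: e - (g e y / c) *: f.

Lemma split_gDC x y : g (D x) y = 2 * a * (g f x / c) * g f y - g (D y) x.
Proof. by rewrite -(split_gD P) (metricC g x); ring. Qed.

(** In the Koszul formula, [split_gDC] trades the symmetric part of D for
    products of coordinates, after which both sides agree term by term. *)
Lemma levi_civita_split x y : levi_civita br g x y =
  (g e x / c) *: skew_part y + (a * g f x / c) *: turn y.
Proof.
apply: (nondegenerate_inj nd) => z; rewrite levi_civitaE // /koszul.
rewrite !(split_bracket P) /skew_part /turn !metricE.
rewrite (split_gDC z x) (split_gDC z y) (split_gDC x y).
field; exact: c0.
Qed.

(** The skew part of D kills the plane, and the rotation takes values in it. *)
Lemma skew_turn y : skew_part (turn y) = 0.
Proof.
apply: (nondegenerate_inj nd) => z.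
rewrite /skew_part /turn linearB !linearZ /= (split_De P) (split_Df P).
rewrite !metricE (split_ff P) (metricC g f e) (split_ef P) !metric0l.
field; exact: c0.
Qed.

(** The skew part of D takes values in the complement of the plane, which the
    rotation kills. *)
Lemma turn_skew y : turn (skew_part y) = 0.
Proof.
rewrite /skew_part /turn !metricE split_eD split_fD (split_ff P) (split_ef P).
by rewrite mulfVK // subrr mulr0 subr0 !mul0r !scale0r subr0.
Qed.

Lemma skew_linear : linear skew_part.
Proof.
move=> b x y; apply: (nondegenerate_inj nd) => z.
by rewrite /skew_part linearP !metricE; ring.
Qed.

Lemma turn_linear : linear turn.
Proof.
move=> b x y; apply: (nondegenerate_inj nd) => z.
by rewrite /turn !metricE; ring.
Qed.

(** The two summands of the connection annihilate each other and each
    commutes with itself, so the commutator of covariant derivatives vanishes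
    and the curvature is minus the covariant derivative along [x, v]. The
    e-coordinate of that bracket is zero, and its f-coordinate is a times
    the area form of the plane. *)
Lemma curvature_split x v w : curvature br g x v w =
  (- a ^+ 2 * ((g e x / c) * (g f v / c) - (g e v / c) * (g f x / c)))
    *: turn w.
Proof.
have skewP b u u' : skew_part (b *: u + u') = b *: skew_part u + skew_part u'.
  exact: skew_linear.
have turnP b u u' : turn (b *: u + u') = b *: turn u + turn u'.
  exact: turn_linear.
have skew0 : skew_part 0 = 0.
  by rewrite /skew_part linear0 metric0r mulr0 mul0r scale0r subrr.
have turn0 : turn 0 = 0.
  by rewrite /turn !metric0r mul0r !scale0r subrr.
have skewZ b u : skew_part (b *: u) = b *: skew_part u.
  by rewrite -[b *: u]addr0 skewP skew0 addr0.
have turnZ b u : turn (b *: u) = b *: turn u.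
  by rewrite -[b *: u]addr0 turnP turn0 addr0.
rewrite curvatureE !levi_civita_split (split_bracket P).
rewrite !(skewP, turnP, skewZ, turnZ, skew_turn, turn_skew, scaler0).
apply: (nondegenerate_inj nd) => z.
rewrite !metricE !split_eD !split_fD metric0l.
field; exact: c0.
Qed.

Lemma ricci_split v w :
  ricci br g v w = - (a ^+ 2 / c ^+ 2) * (g e v * g e w + g f v * g f w).
Proof.
pose phi x : R^o :=
  - a ^+ 2 * ((g e x / c) * (g f v / c) - (g e v / c) * (g f x / c)).
have lphi : linear phi.
  by move=> b x y; rewrite /phi !metricE /GRing.scale /=; ring.
rewrite /ricci.
transitivity (lftrace (linfun (fun x => linfun phi x *: turn w))).
  congr (lftrace (linfun _)); apply: funext => x.
  by rewrite curvature_split (linfun_linearE lphi).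
rewrite lftrace_rank_one (linfun_linearE lphi) /phi /turn !metricE.
rewrite (split_ee P) (split_ff P) (metricC g f e) (split_ef P).
field; exact: c0.
Qed.

Lemma ricci_endo_split v : ricci_endo br g v =
  - (a ^+ 2 / c ^+ 2) *: (g e v *: e + g f v *: f).
Proof.
apply: (nondegenerate_inj nd) => w.
by rewrite -ricci_endoP // ricci_split !metricE.
Qed.

Definition horizontal_proj v := v - (g e v / c) *: e - (g f v / c) *: f.

Lemma horizontal_proj_linear : linear horizontal_proj.
Proof.
move=> b x y; apply: (nondegenerate_inj nd) => z.
by rewrite /horizontal_proj !metricE; ring.
Qed.

(** Any multiple of the projection onto the horizontal space is a derivation:
    that space is an ideal, and the plane complementing it is a subalgebra, so
    the only brackets with a horizontal part are those of e with horizontal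
    vectors, on which both sides scale alike. *)
Lemma horizontal_proj_derivation b :
  derivation br (b *: linfun horizontal_proj).
Proof.
move=> x y; rewrite !scale_lfunE !(linfun_linearE horizontal_proj_linear).
apply: (nondegenerate_inj nd) => z.
rewrite !(split_bracket P) /horizontal_proj !(linearB, linearZ) /=.
rewrite (split_De P) (split_Df P) !metricE !split_eD !split_fD metric0l.
rewrite (split_ee P) (split_ef P).
field; exact: c0.
Qed.

(** The Ricci operator is -a^2/c on the plane and 0 on the horizontal space;
    taking -a^2/c as the soliton constant leaves a multiple of the horizontal
    projection. *)
Lemma split_soliton :
  exists (lambda : R) (delta : 'End(V)),
    derivation br delta /\ ricci_endo br g = lambda *: \1%VF + delta.
Proof.
exists (- (a ^+ 2 / c)), ((a ^+ 2 / c) *: linfun horizontal_proj).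
split; first exact: horizontal_proj_derivation.
apply/lfunP => v; rewrite ricci_endo_split add_lfunE !scale_lfunE id_lfunE.
rewrite (linfun_linearE horizontal_proj_linear).
apply: (nondegenerate_inj nd) => z; rewrite /horizontal_proj !metricE.
field; exact: c0.
Qed.
End NormalForm.

(** * Reduction of pseudo-Kaehler almost abelian algebras to the normal form *)

Section Reduction.
Variables (R : realType) (V : vectType R) (br : {bilinear V -> V -> V}).
Variables (J : 'End(V)) (g : {symmetric V}) (h : {vspace V}).
Hypotheses (Lie : lie_bracket br) (pk : pseudo_kahler br J g).
Hypothesis (ai : codim1_abelian_ideal br h).
Let nd := pk_nondegenerate pk.

Lemma brC x y : br x y = - br y x.
Proof.
have := lie_alternating Lie (x + y).
rewrite linearDl !linearDr /= !(lie_alternating Lie) add0r addr0.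
by move/eqP; rewrite addr_eq0 => /eqP.
Qed.

Lemma metricJC x y : g (J x) y = - g x (J y).
Proof.
by rewrite -(pk_hermitian pk) (complex_sqr (pk_complex pk)) metricNl.
Qed.

Lemma metricJ_alt x : g (J x) x = 0.
Proof. by have := metricJC x x; rewrite (metricC g x); lra. Qed.

Section Normal.
Variable e : V.
Hypotheses (eh : e \in orthov g h) (e0 : g e e != 0).

Lemma orth_normal y : y \in h -> g e y = 0.
Proof. by move/mem_orthovP: eh; apply. Qed.

(** As g(e,e) is nonzero, e is not in h and spans a complement of it. *)
Lemma sub_normal_mem x : x - (g e x / g e e) *: e \in h.
Proof.
have en0 : e != 0 by apply: contraNneq e0 => ->; rewrite metric0l.
have : x \in (<[e]> + h)%VS.
  suff -> : (<[e]> + h)%VS = fullv by rewrite memvf.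
  apply/eqP; rewrite eqEdim subvf -(ideal_codim1 ai) dimv_disjoint_sum.
    by rewrite dim_vline en0 add1n ltnSn.
  apply/eqP; rewrite -subv0; apply/subvP => z.
  rewrite memv_cap => /andP[/vlineP[k ->]] /orth_normal.
  rewrite metricZr => /eqP; rewrite mulf_eq0 (negPf e0) orbF => /eqP ->.
  by rewrite scale0r mem0v.
case/memv_addP => _ /vlineP[k ->] [y yh ->].
by rewrite metricDr metricZr (orth_normal yh) addr0 mulfK // addrC addKr.
Qed.

Lemma memh_orth x : (x \in h) = (g e x == 0).
Proof.
apply/idP/eqP => [/orth_normal //|ex0].
by have := sub_normal_mem x; rewrite ex0 mul0r scale0r subr0.
Qed.

Lemma normal_ad x : g e (br e x) = 0.
Proof.
rewrite -[x](subrK ((g e x / g e e) *: e)) linearDr linearZr /=.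
rewrite (lie_alternating Lie) scaler0 addr0; apply: orth_normal.
exact: (ideal_stable ai) (sub_normal_mem x).
Qed.

(** The components of x and y in h commute. *)
Lemma br_normal x y :
  br x y = (g e x / g e e) *: br e y - (g e y / g e e) *: br e x.
Proof.
have := ideal_abelian ai (sub_normal_mem x) (sub_normal_mem y).
rewrite linearBl !linearBr /= !linearZl_LR !linearZr_LR /=.
rewrite (lie_alternating Lie) !scaler0 subr0 (brC x e) scalerN opprK => /eqP.
by rewrite subr_eq0 => /eqP <-; rewrite addrK.
Qed.

Local Notation f := (J e).
Local Notation c := (g e e).
Local Notation D := (linfun (br e) : 'End(V)).

Definition ad_weight := g (br e f) f / c.
Local Notation a := ad_weight.

Definition horizontal w := g e w = 0 /\ g f w = 0.

Let DE x : D x = br e x.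
Proof. by rewrite lfunE. Qed.

Let gef : g e f = 0.
Proof. by rewrite (metricC g e) metricJ_alt. Qed.

Let gff : g f f = c.
Proof. exact: pk_hermitian pk e e. Qed.

Let mem_h x : g e x = 0 -> x \in h.
Proof. by move=> ex; rewrite memh_orth ex. Qed.

Lemma horizontal_decomposition x :
  exists2 w, horizontal w & x = (g e x / c) *: e + (g f x / c) *: f + w.
Proof.
exists (x - ((g e x / c) *: e + (g f x / c) *: f)); last by rewrite subrKC.
rewrite /horizontal opprD !metricE gff gef (metricC g f e) gef.
by rewrite !mulr0 !mulfVK // subr0 oppr0 add0r !subrr.
Qed.

Let horizontalJ w : horizontal w -> horizontal (J w).
Proof.
case=> ew fw; split; last by rewrite (pk_hermitian pk).
by apply/eqP; rewrite -oppr_eq0 -metricJC fw.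
Qed.

(** In the integrability condition for e and w, the two brackets with f vanish,
    because f, w and J w all lie in the abelian ideal. *)
Lemma horizontal_adJ w : horizontal w -> br e (J w) = J (br e w).
Proof.
move=> hw; have [ew _] := hw; have [eJw _] := horizontalJ hw.
have := complex_integrable (pk_complex pk) e w.
rewrite !(ideal_abelian ai (mem_h gef)) ?mem_h // linear0 addr0 subr0.
move/eqP; rewrite addrC addr_eq0 => /eqP/(congr1 J).
by rewrite (complex_sqr (pk_complex pk)) linearN => /oppr_inj.
Qed.

(** g(f, [e,w]) = -g(e, J [e,w]) = -g(e, [e, J w]), and [e, J w] is in h. *)
Lemma horizontal_ad w : horizontal w -> horizontal (br e w).
Proof.
move=> hw; split; first exact: normal_ad.
by rewrite metricJC -horizontal_adJ // normal_ad oppr0.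
Qed.

(** Closedness of the Kaehler form for e and two elements of h, where only the
    brackets with e survive: ad e is infinitesimally symplectic on h. *)
Lemma closed_ad y z : g e y = 0 -> g e z = 0 ->
  g (J (br e y)) z = g (J (br e z)) y.
Proof.
move=> ey ez; have := pk_closed pk e y z; rewrite /kahler_form.
rewrite (ideal_abelian ai (mem_h ey) (mem_h ez)) linear0 metric0l addr0.
by rewrite (brC z) linearN metricNl => /eqP; rewrite subr_eq0 => /eqP.
Qed.

(** An infinitesimally symplectic map that commutes with J is skew for g. *)
Lemma horizontal_ad_skew x y : horizontal x -> horizontal y ->
  g (br e x) y + g x (br e y) = 0.
Proof.
move=> hx hy; have := closed_ad (proj1 hx) (proj1 (horizontalJ hy)).
rewrite (pk_hermitian pk) horizontal_adJ // (complex_sqr (pk_complex pk)).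
by rewrite metricNl (metricC g x) => ->; rewrite addNr.
Qed.

(** By [closed_ad], g([e,f], w) = g(J [e,f], J w) = g(J [e, J w], f), which
    is g([e, J w], e) = 0. *)
Lemma ad_f_horizontal w : horizontal w -> g (br e f) w = 0.
Proof.
move=> hw; have hJw := horizontalJ hw.
rewrite -(pk_hermitian pk) (@closed_ad f (J w)) ?(proj1 hJw) //.
rewrite metricJC (complex_sqr (pk_complex pk)) metricNr opprK metricC.
exact: normal_ad.
Qed.

(** [e,f] is orthogonal to e and to all horizontal vectors. *)
Lemma ad_f : br e f = a *: f.
Proof.
apply: (nondegenerate_inj nd) => z.
have [w hw ->] := horizontal_decomposition z.
have [_ fw] := hw; rewrite !metricE (ad_f_horizontal hw) fw.
rewrite (metricC g (br e f) e) normal_ad.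
rewrite (metricC g f e) gef gff /ad_weight; field; exact: e0.
Qed.

Lemma split_form_normal : split_form br g e f D a c.
Proof.
have De : br e e = 0 := lie_alternating Lie e.
split; [by []|exact: e0|by []|exact: gff|exact: gef|..].
- by move=> x y; rewrite !DE br_normal.
- by rewrite DE.
- by rewrite DE ad_f.
move=> x y; rewrite !DE.
have [u hu ex] := horizontal_decomposition x.
have [w hw ey] := horizontal_decomposition y.
have brE z t : br e ((g e z / c) *: e + (g f z / c) *: f + t) =
    (g f z / c) *: (a *: f) + br e t.
  by rewrite !linearDr !linearZr_LR /= De ad_f scaler0 add0r.
(* On the right-hand side x and y stay: only their f-coordinates occur there. *)
rewrite {1 2}ex {1 2}ey !brE !metricE.
have [eDu fDu] := horizontal_ad hu; have [eDw fDw] := horizontal_ad hw.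
have [eu fu] := hu; have [ew fw] := hw.
have sym := metricC g.
rewrite (sym f e) (sym (br e u) e) (sym (br e u) f) (sym u f).
rewrite gef gff fw eDu fDu fu eDw fDw.
have /eqP := horizontal_ad_skew hu hw; rewrite addr_eq0 => /eqP ->.
field; exact: e0.
Qed.
End Normal.
End Reduction.

Theorem corollary2p2 (R : realType) (V : vectType R)
    (br : {bilinear V -> V -> V}) (J : 'End(V)) (g : {symmetric V})
    (h : {vspace V}) :
  lie_bracket br ->
  pseudo_kahler br J g ->
  codim1_abelian_ideal br h ->
  non_isotropic J g h ->
  exists (lambda : R) (delta : 'End(V)),
    derivation br delta /\ ricci_endo br g = lambda *: \1%VF + delta.
Proof.
move=> Lie pk ai def.
have [|e eh en0] := @orthov_proper_neq0 _ _ g h.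
  by rewrite -(ideal_codim1 ai).
have e0 : g e e != 0.
  have eh0 : e \in h0 J g h by rewrite -[e]addr0 memv_add ?mem0v.
  case: def => /(_ e eh0 en0); first exact: lt0r_neq0.
  exact: ltr0_neq0.
exact: split_soliton (split_form_normal Lie pk ai eh e0).
Qed.
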